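(* Let $$\mathsf L(\theta)=\mathbb E^{y\sim\kappa}\Big[\mathsf D_E^2\big(\pi(\cdot\mid y),B_\theta(\cdot\,;y)\big)\Big]$$ be the averaged squared energy distance between the posterior $\pi(\cdot\mid y)$ and the pushforward approximation $B_\theta(\cdot\,;y)=T_\theta(\cdot\,;y)_\#\mu_{\mathrm{ref}}$. Minimizing the objective function $\mathsf L(\theta)$ is equivalent to minimizing the objective $\mathsf J(\theta)$, where $$\mathsf J(\theta)=2\,\mathbb E^{(z,(u',y'))\sim\mu_{\mathrm{ref}}\otimes\gamma}\big\|T_\theta(z;y')-u'\big\|-\mathbb E^{(z,z',y'')\sim\mu_{\mathrm{ref}}\otimes\mu_{\mathrm{ref}}\otimes\kappa}\big\|T_\theta(z;y'')-T_\theta(z';y'')\big\|.$$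
   Context: Consider the Bayesian inverse problem of inferring a parameter $u\in\mathcal U$ from an observation $y\in\mathcal Y$ given by the stochastic forward model $y=G(u,\eta)$, where $G:\mathcal U\times\mathcal E\to\mathcal Y$ is the forward operator, $\eta\in\mathcal E$ is random noise, and $u$ has prior distribution $\rho$ on $\mathcal U$. The parameter space $\mathcal U$ carries the norm $\|\cdot\|$ (it may be finite-dimensional or a Banach space of functions). The prior, forward model and noise induce a joint distribution $\gamma$ of $(u,y)$ on $\mathcal U\times\mathcal Y$, with marginal distribution $\kappa$ on the observation space $\mathcal Y$; $\pi(\cdot\mid y)$ denotes the posterior, i.e. the conditional distribution of $u$ given $y$. Let $\mu_{\mathrm{ref}}$ be a reference probability measure on a latent space $\mathcal Z$, and let $T_\theta(\cdot\,;y):\mathcal Z\to\mathcal U$ be an observation-dependent transport map, where $\theta$ denotes the parameters of a neural network or neural operator used to define it. The approximate posterior is the pushforward $B_\theta(\cdot\,;y):=T_\theta(\cdot\,;y)_\#\mu_{\mathrm{ref}}$, i.e. the law of $T_\theta(z;y)$ when $z\sim\mu_{\mathrm{ref}}$. For probability measures $\mu,\nu$ on $\mathcal U$, the energy distance $\mathsf D_E$ is defined by $$\mathsf D_E^2(\mu,\nu):=2\,\mathbb E^{(u,v)\sim\mu\otimes\nu}\|u-v\|-\mathbb E^{(u,u')\sim\mu\otimes\mu}\|u-u'\|-\mathbb E^{(v,v')\sim\nu\otimes\nu}\|v-v'\|.$$ Here $\mathbb E^{x\sim\mu}$ denotes expectation when $x$ has law $\mu$. *)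

(* Defs.v *)
From HB Require Import structures.
From mathcomp Require Import all_boot all_order all_algebra.
From mathcomp Require Import all_classical all_reals all_analysis.

Set Implicit Arguments.
Unset Strict Implicit.
Unset Printing Implicit Defensive.

Import Order.TTheory GRing.Theory Num.Theory.
Import numFieldNormedType.Exports.

Local Open Scope classical_set_scope.
Local Open Scope ring_scope.
Local Open Scope ereal_scope.

(* A notation rather than a definition, so that the measurable structure of
   g_sigma_algebraType is found on [borel U]; the carrier is U itself. *)
Notation borel U := (g_sigma_algebraType (@open U)).

Section energy_distance.
Context {R : realType} {U : normedModType R}.

Definition norm_sub (p : borel U * borel U) : R := `|(p.1 : U) - (p.2 : U)|%R.

(* Extended-real valued: the value is the expected one as soon as the three
   expectations are finite. *)
Definition energy_distance_sq (mu nu : probability (borel U) R) : \bar R :=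
  2%:E * 'E_(mu \x nu)[norm_sub] - 'E_(mu \x mu)[norm_sub]
  - 'E_(nu \x nu)[norm_sub].

End energy_distance.

Section joint_distribution.
Context {R : realType} {dU dY : measure_display}
  {U : measurableType dU} {Y : measurableType dY}.

Section forward_model.
Context {dO dE : measure_display} {O : measurableType dO}
  {E : measurableType dE}.
Variables (P : probability O R) (u : {mfun O >-> U}) (eta : {mfun O >-> E})
  (G : {mfun (U * E)%type >-> Y}).

Definition param_obs (w : O) : U * Y := (u w, G (u w, eta w)).

Let measurable_param_obs : measurable_fun [set: O] param_obs.
Proof.
apply: (measurable_fun_pair (measurable_funPT u)).
apply: (measurableT_comp (measurable_funPT G)).
exact: measurable_fun_pair (measurable_funPT u) (measurable_funPT eta).
Qed.

HB.instance Definition _ :=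
  isMeasurableFun.Build _ _ _ _ param_obs measurable_param_obs.

(* The noise is not required to be independent of the parameter. *)
Definition joint_law : probability (U * Y)%type R := distribution P param_obs.

End forward_model.

Definition obs_proj (p : U * Y) : Y := p.2.

HB.instance Definition _ :=
  isMeasurableFun.Build _ _ _ _ obs_proj (@measurable_snd _ _ U Y).

Definition obs_marginal (gamma : probability (U * Y)%type R) :
  probability Y R := distribution gamma obs_proj.

(* pi is a regular conditional distribution of the first component of gamma
   given the second one. *)
Definition is_posterior (gamma : probability (U * Y)%type R)
    (pi : R.-pker Y ~> U) :=
  forall (A : set U) (B : set Y), measurable A -> measurable B ->
    gamma (A `*` B) = \int[obs_marginal gamma]_(y in B) pi y A.

End joint_distribution.

Section kernel_value.
Context {R : realType} {dU dY : measure_display}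
  {U : measurableType dU} {Y : measurableType dY}.
Variables (pi : R.-pker Y ~> U) (y : Y).

Definition kernel_at : set U -> \bar R := pi y.

HB.instance Definition _ := Measure.on kernel_at.
HB.instance Definition _ :=
  Measure_isProbability.Build _ _ _ kernel_at (prob_kernel y).

End kernel_value.

Section objectives.
Context {R : realType} {U : normedModType R} {dY dZ : measure_display}
  {Y : measurableType dY} {Z : measurableType dZ} {Theta : Type}.
Variables (mu_ref : probability Z R) (T : Theta -> {mfun (Z * Y)%type >-> borel U}).

Definition transport (theta : Theta) (y : Y) (z : Z) : borel U :=
  T theta (z, y).

Let measurable_transport theta y : measurable_fun [set: Z] (transport theta y).
Proof.
apply: (measurableT_comp (measurable_funPT (T theta))).
exact: pair2_measurable.
Qed.

HB.instance Definition _ theta y :=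
  isMeasurableFun.Build _ _ _ _ (transport theta y)
    (measurable_transport theta y).

Definition approx_posterior theta y : probability (borel U) R :=
  distribution mu_ref (transport theta y).

Definition objL (kappa : probability Y R) (pi : R.-pker Y ~> borel U)
    (theta : Theta) : \bar R :=
  \int[kappa]_y energy_distance_sq (kernel_at pi y) (approx_posterior theta y).

Definition data_misfit theta (p : Z * (borel U * Y)) : R :=
  norm_sub (T theta (p.1, p.2.2), p.2.1).

Definition latent_spread theta (p : Z * Z * Y) : R :=
  norm_sub (T theta (p.1.1, p.2), T theta (p.1.2, p.2)).

Definition objJ (gamma : probability (borel U * Y)%type R) (theta : Theta) :
    \bar R :=
  2%:E * 'E_(mu_ref \x gamma)[data_misfit theta]
  - 'E_(mu_ref \x mu_ref \x obs_marginal gamma)[latent_spread theta].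

End objectives.

Section minimization.
Context {R : realType} {Theta : Type}.

Definition minimizer (f : Theta -> \bar R) (theta : Theta) :=
  forall theta', f theta <= f theta'.

Definition minimizing_sequence (f : Theta -> \bar R) (s : nat -> Theta) :=
  f (s n) @[n --> \oo] --> ereal_inf (range f).

(* Minimizing sequences are included so that the equivalence has content even
   when the infimum over the parameters is not attained. *)
Definition equivalent_minimization (f g : Theta -> \bar R) :=
  (forall theta, minimizer f theta <-> minimizer g theta) /\
  (forall s, minimizing_sequence f s <-> minimizing_sequence g s).

End minimization.

(* Main.v *)
Require Import Defs.
From HB Require Import structures.
From mathcomp Require Import all_boot all_order all_algebra.
From mathcomp Require Import all_classical all_reals all_analysis.
From mathcomp Require Import measurable_realfun.

Set Implicit Arguments.
Unset Strict Implicit.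
Unset Printing Implicit Defensive.

(** The two objectives differ by a real constant, and adding a real constant to
    an extended-real objective changes neither its minimizers nor its
    minimizing sequences ([equivalent_minimization_shift]).

    Write [B y] for the law of [T theta (z, y)] under [mu_ref].  The squared
    energy distance between [pi y] and [B y] is [2 a y - b y - c y], where [a]
    is the mean distance between independent draws from [pi y] and [B y], [b]
    the one between two draws from [pi y], and [c] the one between two draws
    from [B y].  Averaging over [kappa]:
    - [a] gives the expected data misfit, because [gamma] is [kappa] followed by
      [pi] ([posterior_disintegration]) and the latent variable is independent
      of the data (Tonelli);
    - [c] gives the expected latent spread (Tonelli again);
    - [b] gives a number that does not depend on [theta].

    What has to be justified is that the integral of [2 a - b - c] may be split
    into three finite ones.  The finite expected misfit makes [a] integrable.
    The triangle inequality through an independent third point gives [b y <= 2 a y]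
    and [c y <= 2 a y] for every [y] ([expectation_norm_sub_triangle]), so [b] and
    [c] are integrable too.  In particular the constant, the average of [b], is finite. *)

Import Order.TTheory GRing.Theory Num.Theory.
Import numFieldNormedType.Exports.

Local Open Scope classical_set_scope.
Local Open Scope ring_scope.
Local Open Scope ereal_scope.

(** * Minimization and additive constants *)

Lemma le_ereal_inf_range_shift (R : realType) (I : Type) (g : I -> \bar R)
    (c : R) :
  ereal_inf (range g) + c%:E <= ereal_inf (range (fun t => g t + c%:E)).
Proof.
apply: le_ereal_inf_tmp => _ [t _ <-].
by apply: leeD2r; apply: ereal_inf_lbound; exists t.
Qed.

Lemma ereal_inf_range_shift (R : realType) (I : Type) (g : I -> \bar R)
    (c : R) :
  ereal_inf (range (fun t => g t + c%:E)) = ereal_inf (range g) + c%:E.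
Proof.
apply/eqP; rewrite eq_le le_ereal_inf_range_shift andbT.
(* The converse inequality is the previous one for the shift by [- c]. *)
have := le_ereal_inf_range_shift (fun t => g t + c%:E) (- c).
under [in X in _ <= X -> _]eq_fun do rewrite EFinN addeK//.
by rewrite EFinN leeBlDr.
Qed.

(** A shift by a real constant preserves the order and commutes with infima and
    limits.  Being undone by the opposite shift, it has to be followed in one
    direction only. *)
Lemma equivalent_minimization_shift (R : realType) (I : Type)
    (f g : I -> \bar R) (c : R) :
  (forall t, f t = g t + c%:E) -> equivalent_minimization f g.
Proof.
move=> /funext fE.
have gE : g = fun t => f t + (- c)%:E.
  by rewrite fE; apply/funext => t; rewrite EFinN addeK.
have shift_cvg (h : I -> \bar R) (b : R) s : minimizing_sequence h s ->
    minimizing_sequence (fun t => h t + b%:E) s.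
  rewrite /minimizing_sequence ereal_inf_range_shift => hs.
  by apply: cvgeD => //; [rewrite fin_num_adde_defl|exact: cvg_cst].
split=> [t|s].
- by rewrite fE; split=> tmin t'; have := tmin t'; rewrite leeD2rE.
- split=> ?; [rewrite gE|rewrite fE]; exact: shift_cvg.
Qed.

(** * Disintegration of the joint law along the observation *)

Section kernel_precomposition.
Context {R : realType} {dX dY dU : measure_display}
  {X : measurableType dX} {Y : measurableType dY} {U : measurableType dU}.
Variables (k : R.-pker Y ~> U) (g : X -> Y).

(** Carries the measurability proof as an argument so that the kernel structure
    can be found from the term alone, as for [kdirac]. *)
Definition kprecomp (mg : measurable_fun setT g) (x : X) :
  {measure set U -> \bar R} := k (g x).

Hypothesis mg : measurable_fun setT g.

Let measurable_kprecomp A : measurable A ->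
  measurable_fun setT (kprecomp mg ^~ A).
Proof.
by move=> mA; exact: (measurableT_comp (measurable_kernel k A mA) mg).
Qed.

HB.instance Definition _ :=
  isKernel.Build _ _ _ _ _ (kprecomp mg) measurable_kprecomp.

Let kprecomp_prob x : kprecomp mg x setT = 1.
Proof. exact: prob_kernel. Qed.

HB.instance Definition _ :=
  Kernel_isProbability.Build _ _ _ _ _ (kprecomp mg) kprecomp_prob.

End kernel_precomposition.

Section disintegration.
Context {R : realType} {dU dY : measure_display}
  {U : measurableType dU} {Y : measurableType dY}.
Variables (gamma : probability (U * Y)%type R) (pi : R.-pker Y ~> U).

(* [gamma] is rebuilt by composing kernels, starting from the one-point space:
   draw the observation from its marginal, then the parameter
   from the posterior, then put the two together by a Dirac kernel.  Integrals
   against compositions of kernels are iterated integrals. *)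
Let kappa_const (_ : unit) : pprobability Y R := obs_marginal gamma.

Let measurable_kappa_const : measurable_fun setT kappa_const.
Proof. exact: measurable_cst. Qed.

Let kappa_ker := kprobability measurable_kappa_const.

Let pair_obs (p : unit * Y * U) : U * Y := (p.2, p.1.2).

Let measurable_pair_obs : measurable_fun setT pair_obs.
Proof.
apply: measurable_fun_pair => //.
exact: (measurableT_comp measurable_snd).
Qed.

Let posterior_of_obs : R.-pker (unit * Y) ~> U :=
  kprecomp pi measurable_snd.

Let glue := mkcomp posterior_of_obs (kdirac measurable_pair_obs).

Let joint : {measure set (U * Y) -> \bar R} := mkcomp kappa_ker glue tt.

Let integral_joint f : (forall x, 0 <= f x) -> measurable_fun setT f ->
  \int[joint]_x f x = \int[obs_marginal gamma]_y \int[pi y]_u f (u, y).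
Proof.
move=> f0 mf; rewrite /joint integral_kcomp//.
apply: eq_integral => y _; rewrite integral_kcomp//.
by apply: eq_integral => v _; rewrite integral_dirac// diracT mul1e.
Qed.

Let jointX : is_posterior gamma pi -> forall A B,
  measurable A -> measurable B -> joint (A `*` B) = gamma (A `*` B).
Proof.
move=> post A B mA mB; have mAB := measurableX mA mB.
have measure_indic (m : {measure set (U * Y) -> \bar R}) :
    m (A `*` B) = \int[m]_x (\1_(A `*` B) x)%:E.
  by rewrite integral_indic// setIT.
rewrite (measure_indic joint) integral_joint//; last first.
  by apply/measurable_EFinP; exact: measurable_indic.
rewrite post// [RHS]integral_mkcond.
apply: eq_integral => y _ /=; rewrite patchE.
under eq_integral => v _.
  rewrite (_ : \1_(A `*` B) (v, y) = \1_A v * \1_B y)%R; last first.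
    by rewrite !indicE in_setX/= -natrM mulnb.
  over.
rewrite [\1_B y]indicE; case: (y \in B) => /=.
  under eq_integral do rewrite mulr1.
  by rewrite integral_indic// setIT.
by under eq_integral do rewrite mulr0; rewrite integral0.
Qed.

(* Two finite measures that agree on the rectangles, a pi-system generating the
   product sigma-algebra, are equal. *)
Let jointE : is_posterior gamma pi ->
  forall A, measurable A -> joint A = gamma A.
Proof.
move=> post.
pose rectangles : set (set (U * Y)) :=
  [set A `*` B | A in measurable & B in measurable].
apply: (@measure_unique _ _ _ rectangles (fun=> setT)) => //.
- exact: measurable_prod_measurableType.
- move=> _ _ [A1 mA1 [B1 mB1 <-]] [A2 mA2 [B2 mB2 <-]]; rewrite -setXI.
  exists (A1 `&` A2); first exact: measurableI.
  by exists (B1 `&` B2); first exact: measurableI.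
- by move=> _; exists setT => //; exists setT => //; rewrite setXTT.
- by rewrite bigcup_const.
- by move=> _ [A mA [B mB <-]]; exact: jointX.
- move=> _ /=; rewrite -setXTT jointX// setXTT.
  by rewrite probability_setT ltry.
Qed.

(** [is_posterior] only speaks of rectangles; this is its extension to every
    nonnegative integrand, from which the misfit is averaged over [gamma] by
    averaging first over the posterior. *)
Lemma posterior_disintegration (f : U * Y -> \bar R) :
  is_posterior gamma pi -> (forall p, 0 <= f p) -> measurable_fun setT f ->
  \int[gamma]_p f p = \int[obs_marginal gamma]_y \int[pi y]_u f (u, y).
Proof.
move=> post f0 mf; rewrite -integral_joint//.
by apply: eq_measure_integral => A mA _; rewrite jointE.
Qed.

End disintegration.

(** * Mean distances between independent draws *)

Lemma integral_probability_cst (R : realType) (d : measure_display)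
    (T : measurableType d) (P : probability T R) (c : \bar R) :
  \int[P]_x c = c.
Proof.
rewrite (integral_cst P measurableT c) [X in c * X](_ : _ = 1) ?mule1//.
exact: probability_setT.
Qed.

(** A draw from a pushforward law may be replaced by the image of a draw from the
    original law, also when it comes with an independent companion. *)
Lemma ge0_integral_product_distribution (R : realType)
    (dA dB dW : measure_display) (A : measurableType dA)
    (B : measurableType dB) (W : measurableType dW)
    (m : probability A R) (P : probability W R) (X : {mfun W >-> B})
    (h : A * B -> \bar R) :
  (forall p, 0 <= h p) -> measurable_fun setT h ->
  \int[m \x distribution P X]_p h p = \int[m]_a \int[P]_w h (a, X w).
Proof.
move=> h0 mh; rewrite fubini_tonelli1//.
apply: eq_integral => a _; rewrite /fubini_F ge0_integral_distribution//.
exact: (measurableT_comp mh (pair1_measurable _)).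
Qed.

Section energy_triangle.
Context {R : realType} {U : normedModType R}.
Hypothesis hnorm : measurable_fun [set: borel U * borel U] (@norm_sub R U).

Lemma norm_subC (x y : borel U) : norm_sub (x, y) = norm_sub (y, x).
Proof. exact: distrC. Qed.

Lemma norm_sub_ge0 (p : borel U * borel U) : 0 <= (norm_sub p)%:E.
Proof. by rewrite lee_fin; exact: normr_ge0. Qed.

Lemma norm_sub_triangle (x y z : borel U) :
  ((norm_sub (x, y))%:E <= (norm_sub (x, z))%:E + (norm_sub (y, z))%:E).
Proof.
by rewrite -EFinD lee_fin (norm_subC y); exact: ler_distD.
Qed.

Let mnorm : measurable_fun setT (fun p => (@norm_sub R U p)%:E).
Proof. exact/measurable_EFinP. Qed.

Let mnorm1 (x : borel U) :
  measurable_fun setT (fun v => (norm_sub (x, v))%:E).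
Proof. exact: (measurableT_comp mnorm (pair1_measurable _)). Qed.

Lemma expectation_norm_subE (mu nu : probability (borel U) R) :
  'E_(mu \x nu)[norm_sub] = \int[mu]_x \int[nu]_v (norm_sub (x, v))%:E.
Proof.
rewrite unlock fubini_tonelli1//; exact: norm_sub_ge0.
Qed.

Lemma expectation_norm_subC (mu nu : probability (borel U) R) :
  'E_(mu \x nu)[norm_sub] = 'E_(nu \x mu)[norm_sub].
Proof.
rewrite !expectation_norm_subE.
rewrite (fubini_tonelli (m1 := mu) (m2 := nu) _ mnorm norm_sub_ge0).
apply: eq_integral => v _; apply: eq_integral => x _.
by rewrite norm_subC.
Qed.

(** Compare two draws [x], [x'] from [mu] through a third independent draw [v]
    from [nu]: the distance between [x] and [x'] is at most the sum of their
    distances to [v], and both of these have the same mean. *)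
Lemma expectation_norm_sub_triangle (mu nu : probability (borel U) R) :
  'E_(mu \x mu)[norm_sub] <= 2%:E * 'E_(mu \x nu)[norm_sub].
Proof.
pose g x := \int[nu]_v (norm_sub (x, v))%:E.
have g0 x : 0 <= g x by apply: integral_ge0 => v _; exact: norm_sub_ge0.
have mg : measurable_fun setT g.
  exact: (measurable_fun_fubini_tonelli_F _ mnorm norm_sub_ge0).
(* [nu] is a probability, so the left-hand side is its own mean over [v]. *)
have leg x x' : (norm_sub (x, x'))%:E <= g x + g x'.
  rewrite /g -ge0_integralD//; [|by move=> *; exact: norm_sub_ge0..].
  rewrite -[leLHS](integral_probability_cst nu).
  apply: ge0_le_integral => //.
  - by move=> *; exact: norm_sub_ge0.
  - by apply: emeasurable_funD.
  - by move=> v _; exact: norm_sub_triangle.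
have integral_gD x : \int[mu]_x' (g x + g x') = g x + \int[mu]_x' g x'.
  by rewrite ge0_integralD// (integral_probability_cst mu (g x)).
rewrite (expectation_norm_subE mu nu) -/g.
have -> : 2%:E * \int[mu]_x g x = \int[mu]_x \int[mu]_x' (g x + g x').
  under [RHS]eq_integral do rewrite integral_gD.
  rewrite [RHS]ge0_integralD//; last by move=> *; exact: integral_ge0.
  rewrite (integral_probability_cst mu (\int[mu]_x g x)).
  by rewrite mule_natl mule2n.
rewrite expectation_norm_subE; apply: ge0_le_integral => //.
- by move=> x _; apply: integral_ge0 => *; exact: norm_sub_ge0.
- exact: (measurable_fun_fubini_tonelli_F _ mnorm norm_sub_ge0).
- by under eq_fun do rewrite integral_gD; apply: emeasurable_funD.
move=> x _; apply: ge0_le_integral => //.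
- by move=> *; exact: norm_sub_ge0.
- by apply: emeasurable_funD.
Qed.

End energy_triangle.

(** * Averages over the observation *)

Section averaged_energy.
Context {R : realType} {U : normedModType R} {dY dZ : measure_display}
  {Y : measurableType dY} {Z : measurableType dZ} {Theta : Type}.
Hypothesis hnorm : measurable_fun [set: borel U * borel U] (@norm_sub R U).
Variables (gamma : probability (borel U * Y)%type R)
  (pi : R.-pker Y ~> borel U) (hpost : is_posterior gamma pi)
  (mu_ref : probability Z R)
  (T : Theta -> {mfun (Z * Y)%type >-> borel U}) (theta : Theta).

Let kappa := obs_marginal gamma.
Let B y := approx_posterior mu_ref T theta y.

Let mnorm : measurable_fun setT (fun p => (@norm_sub R U p)%:E).
Proof. exact/measurable_EFinP. Qed.

Let mT : measurable_fun setT (T theta).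
Proof. exact: measurable_funPT. Qed.

Let measurable_misfit :
  measurable_fun setT (fun p => (data_misfit T theta p)%:E).
Proof.
apply: (measurableT_comp mnorm); apply: measurable_fun_pair.
- apply: (measurableT_comp mT); apply: measurable_fun_pair => //.
  exact: (measurableT_comp measurable_snd measurable_snd).
- exact: (measurableT_comp measurable_fst measurable_snd).
Qed.

Let measurable_spread :
  measurable_fun setT (fun p => (latent_spread T theta p)%:E).
Proof.
apply: (measurableT_comp mnorm); apply: measurable_fun_pair;
  apply: (measurableT_comp mT); apply: measurable_fun_pair => //.
- exact: (measurableT_comp measurable_fst measurable_fst).
- exact: (measurableT_comp measurable_snd measurable_fst).
Qed.

Let misfit_at (p : borel U * Y) :=
  \int[mu_ref]_z (data_misfit T theta (z, p))%:E.

Let misfit_at_ge0 p : 0 <= misfit_at p.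
Proof. by apply: integral_ge0 => z _; exact: norm_sub_ge0. Qed.

Let measurable_misfit_at : measurable_fun setT misfit_at.
Proof.
apply: (measurable_fun_fubini_tonelli_G _ measurable_misfit) => p.
exact: norm_sub_ge0.
Qed.

Let cross_energyE y :
  'E_(kernel_at pi y \x B y)[norm_sub] = \int[pi y]_u misfit_at (u, y).
Proof.
rewrite unlock (ge0_integral_product_distribution (kernel_at pi y) mu_ref
  (transport T theta y) norm_sub_ge0 mnorm).
apply: eq_integral => u _; apply: eq_integral => z _.
by rewrite norm_subC.
Qed.

Let measurable_cross_energy : measurable_fun setT
  (fun y => 'E_(kernel_at pi y \x B y)[norm_sub]).
Proof.
under eq_fun do rewrite cross_energyE.
apply: (measurable_fun_integral_finite_kernel
  (fun p : Y * borel U => misfit_at (p.2, p.1)) pi) => //.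
apply: (measurableT_comp measurable_misfit_at).
exact: measurable_fun_pair.
Qed.

(** An observation drawn from [kappa], paired with a posterior draw given it, has
    law [gamma]; the latent variable is independent of both. *)
Lemma integral_cross_energy :
  \int[kappa]_y 'E_(kernel_at pi y \x B y)[norm_sub] =
  'E_(mu_ref \x gamma)[data_misfit T theta].
Proof.
rewrite unlock fubini_tonelli2//; last by move=> p; exact: norm_sub_ge0.
rewrite (posterior_disintegration hpost)//.
by apply: eq_integral => y _; rewrite -[RHS]cross_energyE unlock.
Qed.

Let model_energyE y : 'E_(B y \x B y)[norm_sub] =
  \int[mu_ref \x mu_ref]_z (latent_spread T theta (z, y))%:E.
Proof.
rewrite unlock (ge0_integral_product_distribution (B y) mu_ref
  (transport T theta y) norm_sub_ge0 mnorm).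
rewrite [LHS]ge0_integral_distribution//; last 2 first.
- apply: (measurable_fun_fubini_tonelli_F (m2 := mu_ref)
    (fun p => (norm_sub (p.1, transport T theta y p.2))%:E)).
  + apply: (measurableT_comp mnorm); apply: measurable_fun_pair => //.
    exact: (measurableT_comp (measurable_funPT (transport T theta y))
      measurable_snd).
  + by move=> p; exact: norm_sub_ge0.
- by move=> x; apply: integral_ge0 => z _; exact: norm_sub_ge0.
rewrite (fubini_tonelli1 (fun z => (latent_spread T theta (z, y))%:E))//.
- exact: (measurableT_comp measurable_spread (pair2_measurable _)).
- by move=> p; exact: norm_sub_ge0.
Qed.

Let measurable_model_energy : measurable_fun setT
  (fun y => 'E_(B y \x B y)[norm_sub]).
Proof.
under eq_fun do rewrite model_energyE.
apply: (measurable_fun_fubini_tonelli_G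
  (m1 := (mu_ref \x mu_ref : probability (Z * Z)%type R))
  (fun p => (latent_spread T theta p)%:E) measurable_spread) => p.
exact: norm_sub_ge0.
Qed.

Lemma integral_model_energy :
  \int[kappa]_y 'E_(B y \x B y)[norm_sub] =
  'E_(mu_ref \x mu_ref \x kappa)[latent_spread T theta].
Proof.
under eq_integral do rewrite model_energyE.
rewrite unlock [RHS]fubini_tonelli2//; last by move=> p; exact: norm_sub_ge0.
Qed.

(* Both draws come from a law that depends on [y], so Tonelli for a fixed product
   measure is replaced by two integrations against the kernel [pi]; the inner
   one is parametrized by [y] and the first draw, whence the precomposition with
   the first projection. *)
Let measurable_posterior_energy : measurable_fun setT
  (fun y => 'E_(kernel_at pi y \x kernel_at pi y)[norm_sub]).
Proof.
under eq_fun do rewrite expectation_norm_subE//.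
apply: (measurable_fun_integral_finite_kernel
  (fun p : Y * borel U => \int[pi p.1]_v (norm_sub (p.2, v))%:E) pi).
- by move=> p; apply: integral_ge0 => v _; exact: norm_sub_ge0.
- apply: (measurable_fun_integral_finite_kernel
    (fun q : Y * borel U * borel U => (norm_sub (q.1.2, q.2))%:E)
    (kprecomp pi measurable_fst)).
  + by move=> q; exact: norm_sub_ge0.
  + apply: (measurableT_comp mnorm); apply: measurable_fun_pair => //.
    exact: (measurableT_comp measurable_snd measurable_fst).
Qed.

Let expectation_norm_sub_ge0 (mu nu : probability (borel U) R) :
  0 <= 'E_(mu \x nu)[norm_sub].
Proof. by rewrite unlock; apply: integral_ge0 => p _; exact: norm_sub_ge0. Qed.

Hypothesis hfin :
  (mu_ref \x gamma).-integrable setT (EFin \o data_misfit T theta).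

Let integrable_cross_energy : kappa.-integrable setT
  (fun y => 'E_(kernel_at pi y \x B y)[norm_sub]).
Proof.
apply/integrableP; split=> //.
under eq_integral do rewrite gee0_abs//.
rewrite integral_cross_energy unlock.
exact: (integrable_lty measurableT hfin).
Qed.

Let integrable_twice_cross_energy : kappa.-integrable setT
  (fun y => 2%:E * 'E_(kernel_at pi y \x B y)[norm_sub]).
Proof. exact: integrableZl. Qed.

Let integrable_posterior_energy : kappa.-integrable setT
  (fun y => 'E_(kernel_at pi y \x kernel_at pi y)[norm_sub]).
Proof.
apply: le_integrable integrable_twice_cross_energy => // y _.
by rewrite !gee0_abs ?mule_ge0//; exact: expectation_norm_sub_triangle.
Qed.

Let integrable_model_energy : kappa.-integrable setT
  (fun y => 'E_(B y \x B y)[norm_sub]).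
Proof.
apply: le_integrable integrable_twice_cross_energy => // y _.
rewrite !gee0_abs ?mule_ge0//.
rewrite (expectation_norm_subC hnorm (kernel_at pi y)).
exact: expectation_norm_sub_triangle.
Qed.

(** The mean distance between two posterior draws is the part of the energy
    distance that does not see [theta].  Nothing is lost by [fine]: that mean is
    integrable, being at most twice the one between posterior and model. *)
Lemma objL_objJ :
  objL mu_ref T kappa pi theta = objJ mu_ref T gamma theta +
  (- fine (\int[kappa]_y
             'E_(kernel_at pi y \x kernel_at pi y)[norm_sub]))%:E.
Proof.
rewrite /objL /objJ /energy_distance_sq integralB//; last exact: integrableB.
rewrite integralB// integralZl// integral_cross_energy integral_model_energy.
by rewrite addeAC EFinN fineK// integrable_fin_num.
Qed.

End averaged_energy.

Theorem lemma2p1 (R : realType) (U : normedModType R)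
    (dO dE dY dZ : measure_display)
    (O : measurableType dO) (E : measurableType dE)
    (Y : measurableType dY) (Z : measurableType dZ)
    (hnorm : measurable_fun [set: (borel U * borel U)%type] (@norm_sub R U))
    (P : probability O R)
    (rho : probability (borel U) R)
    (u : {mfun O >-> borel U}) (eta : {mfun O >-> E})
    (hprior : forall A : set (borel U), measurable A ->
       distribution P u A = rho A)
    (G : {mfun (borel U * E)%type >-> Y})
    (pi : R.-pker Y ~> borel U)
    (hpost : is_posterior (joint_law P u eta G) pi)
    (mu_ref : probability Z R)
    (Theta : Type) (T : Theta -> {mfun (Z * Y)%type >-> borel U})
    (hfin : forall theta : Theta,
       (mu_ref \x joint_law P u eta G).-integrable setT
         (EFin \o data_misfit T theta)) :
  equivalent_minimization
    (objL mu_ref T (obs_marginal (joint_law P u eta G)) pi)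
    (objJ mu_ref T (joint_law P u eta G)).
Proof.
apply: equivalent_minimization_shift => theta.
exact: objL_objJ.
Qed.
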